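(* Let $f$ and $g$ be (normalised) cuspidal eigenforms on the group $\Gamma_0(N)$ of weights $k_1$ and $k_2$ respectively, with $k_1\neq k_2$. Then: (1) there exists a positive integer $n=O\left(\left(\log(N)+\log(N)^{0.525}\right)^2\right)$ such that $a_n(f)\neq a_n(g)$; (2) assuming the Riemann hypothesis, there exists a positive integer $n=O\left(\left(\log(N)+\log(N)^{0.5}\log\log(N)\right)^2\right)$ such that $a_n(f)\neq a_n(g)$; (3) assuming Cramér's conjecture on prime gaps, there exists a positive integer $n=O\left(\left(\log(N)+(\log\log(N))^2\right)^2\right)$ such that $a_n(f)\neq a_n(g)$.
   Context: A cuspidal eigenform of weight $k$ on $\Gamma_0(N)$ is a nonzero cusp form of weight $k$ (with trivial character) on $\Gamma_0(N)\subset \mathrm{SL}_2(\mathbb{Z})$ that is a simultaneous eigenvector of all Hecke operators $T_n$, $n\geq 1$; it is not required to be a newform. $a_n(f)$ denotes the coefficient of $q^n$ in the Fourier expansion $f=\sum_{n\geq 1}a_n(f)q^n$ at the cusp $\infty$, $q=e^{2\pi i z}$. All cuspidal eigenforms are assumed normalised so that $a_1(f)=1$. $\log$ is the natural logarithm, and $\log(N)^{c}$ means $(\log N)^{c}$. The $O$-notation is asymptotic as $N\to\infty$: ''there exists $n=O(B(N))$ such that $a_n(f)\neq a_n(g)$'' means that there are absolute constants $C>0$ and $N_0$, independent of $f$, $g$, $k_1$, $k_2$ and $N$, such that for every $N\geq N_0$ and all $f,g$ as in the statement there is a positive integer $n\leq C\,B(N)$ with $a_n(f)\neq a_n(g)$.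 Let $p_k$ denote the $k$-th smallest prime number. Cramér's conjecture on prime gaps is the assertion that $p_{k+1}-p_k=O(\log^2(p_k))$ as $k\to\infty$. *)

(* Defs.v *)
From HB Require Import structures.
From mathcomp Require Import all_boot all_order all_algebra.
From mathcomp Require Import all_classical all_reals all_analysis.
From mathcomp Require Import complex.

Set Implicit Arguments.
Unset Strict Implicit.
Unset Printing Implicit Defensive.

Import Order.TTheory GRing.Theory Num.Theory.
Import numFieldNormedType.Exports.

Local Open Scope classical_set_scope.
Local Open Scope ring_scope.
Local Open Scope complex_scope.

(* The topology of the complex numbers R[i] is carried by the alias R[i]^o,
   a normed module over R[i] itself: [derivable] at R[i]^o is therefore complex
   differentiability. *)
Section ComplexAnalysis.
Variable R : realType.
Implicit Types (z s : R[i]) (f : R[i] -> R[i]) (D : set R[i]).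

Definition expC z : R[i] :=
  (expR (complex.Re z))%:C * (cos (complex.Im z) +i* sin (complex.Im z)).

Definition holomorphic_on D f : Prop :=
  forall z, D z -> derivable (f : R[i]^o -> R[i]^o) z 1.

Definition has_sum (u : nat -> R[i]) (l : R[i]) : Prop :=
  series (u : nat -> R[i]^o) @ \oo --> (l : R[i]^o).

Definition upper_half_plane : set R[i] := [set z | 0 < complex.Im z].

End ComplexAnalysis.

Section ModularForms.
Variable R : realType.
Implicit Types (z : R[i]) (f : R[i] -> R[i]) (A : 'M[int]_2) (k : int).
Implicit Types (N n : nat).

(* Functions on the upper half-plane are total functions on R[i] whose values
   elsewhere are never constrained. *)
Local Notation H := (@upper_half_plane R).

Definition SL2Z : set 'M[int]_2 := [set A | \det A = 1].

Definition Gamma0 N : set 'M[int]_2 :=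
  [set A | SL2Z A /\ (N%:Z %| A 1%R 0%R)%Z].

Definition automorphy_factor A z : R[i] := (A 1 0)%:~R * z + (A 1 1)%:~R.

Definition moebius A z : R[i] :=
  ((A 0 0)%:~R * z + (A 0 1)%:~R) / automorphy_factor A z.

(* Only used for matrices of determinant 1, so there is no power of the
   determinant. *)
Definition slash k A f z : R[i] :=
  automorphy_factor A z ^ (- k) * f (moebius A z).

(* q_h = exp (2 pi i z / h) *)
Definition nome (h : nat) z : R[i] := expC ((0 +i* (2 * pi)) * z / h%:R).

Definition fourier_expansion (h : nat) f (a : nat -> R[i]) : Prop :=
  forall z, H z -> has_sum (fun n => a n * nome h z ^+ n) (f z).

(* For A in SL_2(Z), f |_k A describes f at the cusp A(oo). It is invariant
   under z |-> z + N because Gamma(N) is contained in Gamma_0(N), hence the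
   expansion in powers of q_N; the absence of negative powers is holomorphy at
   the cusp, and b_0 = 0 is vanishing there. *)
Definition vanishes_at_cusps N k f : Prop :=
  forall A, SL2Z A ->
    exists2 b : nat -> R[i], b 0%N = 0 & fourier_expansion N (slash k A f) b.

Definition cusp_form N k f : Prop :=
  [/\ holomorphic_on H f,
      forall A z, Gamma0 N A -> H z -> slash k A f z = f z
    & vanishes_at_cusps N k f].

(* T_n on weight k, level N and trivial character. The matrices (a b; 0 d) with
   a d = n, gcd(a, N) = 1 and 0 <= b < d represent the left Gamma_0(N)-cosets of
   the integral matrices of determinant n whose lower left entry is divisible by
   N and whose upper left entry is prime to N. For a prime n = p dividing N this
   is the operator U_p. *)
Definition hecke N k n f z : R[i] :=
  n%:R ^ (k - 1) *
  \sum_(a <- divisors n | coprime a N)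
    \sum_(b < n %/ a)
      (n %/ a)%:R ^ (- k) * f ((a%:R * z + b%:R) / (n %/ a)%:R).

Definition cuspidal_eigenform N k f : Prop :=
  [/\ cusp_form N k f,
      exists2 z, H z & f z != 0
    & forall n, (0 < n)%N ->
        exists lambda : R[i], forall z, H z -> hecke N k n f z = lambda * f z].

(* [a n] is the coefficient a_n(f) at the cusp oo, where the width is 1. It is
   determined by f, by uniqueness of power series coefficients. *)
Definition normalised_eigenform N k f (a : nat -> R[i]) : Prop :=
  [/\ cuspidal_eigenform N k f, fourier_expansion 1 f a & a 1%N = 1].

(* Eigenforms of level N and distinct weights differ at some coefficient of
   index n = O(B(N)) as N -> oo; C and N0 do not depend on the forms, on their
   weights or on N. *)
Definition coefficients_differ_within (B : R -> R) : Prop :=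
  exists (C : R) (N0 : nat), 0 < C /\
    forall N, (0 < N)%N -> (N0 <= N)%N ->
    forall (k1 k2 : int) (f g : R[i] -> R[i]) (a b : nat -> R[i]),
      normalised_eigenform N k1 f a ->
      normalised_eigenform N k2 g b ->
      k1 <> k2 ->
      exists n : nat, [/\ (0 < n)%N, n%:R <= C * B N%:R & a n <> b n].

End ModularForms.

Section PrimeNumberHypotheses.
Variable R : realType.

(* Analytic continuation of the Dirichlet series sum_{n >= 1} n^(-s) to
   C \ {1}. It is unique; the value at s = 1 is irrelevant. *)
Definition riemann_zeta (zeta : R[i] -> R[i]) : Prop :=
  holomorphic_on [set s | s <> 1] zeta /\
  forall s : R[i], 1 < complex.Re s ->
    has_sum (fun n => expC (- s * (ln n.+1%:R)%:C)) (zeta s).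

Definition riemann_hypothesis : Prop :=
  forall zeta, riemann_zeta zeta ->
  forall s : R[i], s <> 1 -> zeta s = 0 ->
    (forall m : nat, s <> - 2 * m.+1%:R) ->
    complex.Re s = 1 / 2.

Lemma exists_larger_prime (m : nat) : exists p, ((m < p) && prime p)%N.
Proof. by have [p m_lt_p p_pr] := prime_above m; exists p; rewrite m_lt_p. Qed.

Definition next_prime (m : nat) : nat := ex_minn (exists_larger_prime m).

(* 1-based: nth_prime 1 = 2, nth_prime 2 = 3; nth_prime 0 = 0 is a dummy. *)
Definition nth_prime (k : nat) : nat := iter k next_prime 0%N.

Definition cramer_conjecture : Prop :=
  exists (C : R) (K : nat), forall k : nat, (0 < k)%N -> (K <= k)%N ->
    (nth_prime k.+1)%:R - (nth_prime k)%:R <= C * ln (nth_prime k)%:R ^+ 2.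

End PrimeNumberHypotheses.

(* Main.v *)
(* All three bounds are at least (log N)^2, so it suffices to find, without any
   hypothesis on primes, an index n = O((log N)^2). Let p be the least prime not
   dividing N. Since T_p f = a_p(f) f, comparing p-th coefficients gives
   a_{p^2}(f) = a_p(f)^2 - p^(k - 1); if f and g agree at p and p^2, then
   p^(k1 - 1) = p^(k2 - 1) and k1 = k2. All primes below p divide N, so
   Chebyshev's lower bound for the product of these primes, read off from the
   prime factorisation of binomial(2 m, m), gives p = O(log N). *)
Require Import Defs.
From mathcomp Require Import all_boot all_order all_algebra.
From mathcomp Require Import all_classical all_reals all_analysis.
From mathcomp Require Import complex ring lra zify.
Local Open Scope ring_scope.

Module Import Auxiliary.

Set Implicit Arguments.
Unset Strict Implicit.
Unset Printing Implicit Defensive.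
Import Order.TTheory GRing.Theory Num.Theory.
Import numFieldNormedType.Exports.

(** * Chebyshev's lower bound for products of primes *)

Section Chebyshev.
Local Open Scope nat_scope.

(** Induction through (m + 1) C(2m + 2, m + 1) = 2 (2m + 1) C(2m, m), which [h1] and [h2] combine to
    give. *)
Lemma central_bin_lower_bound n : 0 < n -> 4 ^ n <= n.*2 * 'C(n.*2, n).
Proof.
case: n => // n _; elim: n => // n IHn.
have h1 := mul_bin_diag n.+2.*2 n.+1.
have h2 := mul_bin_down n.+2.*2.-1 n.+1.
rewrite (_ : n.+2.*2.-1.-1 = n.+1.*2) in h2; last by lia.
rewrite expnS; nia.
Qed.

Lemma sum_leq_indicator m t : \sum_(1 <= k < m.+1) (k <= t) <= t.
Proof.
suff -> : \sum_(1 <= k < m.+1) (k <= t) = minn m t by exact: geq_minr.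
elim: m => [|m IHm]; first by rewrite big_geq // min0n.
by rewrite big_nat_recr //= IHm; case: leqP; lia.
Qed.

(** A common range in Legendre's formula lets the exponents in n! and (2n)! be compared term by
    term; the added terms vanish because n < p^k. *)
Lemma logn_fact_widen p n m : prime p -> n <= m ->
  logn p n`! = \sum_(1 <= k < m.+1) n %/ p ^ k.
Proof.
move=> p_pr le_nm; rewrite logn_fact // (@big_cat_nat _ _ _ n.+1 1 m.+1) //=.
rewrite [X in _ = _ + X]big_nat_cond [X in _ = _ + X]big1 ?addn0 // => k.
rewrite andbT => /andP[lt_nk _]; rewrite divn_small //.
exact: leq_trans lt_nk (ltnW (ltn_expl k (prime_gt1 p_pr))).
Qed.

(* Each term of Legendre's formula contributes at most 1, and only while
   p ^ k <= 2 n. *)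
Lemma logn_central_bin p n : prime p -> 0 < n ->
  logn p 'C(n.*2, n) <= trunc_log p n.*2.
Proof.
move=> p_pr n_gt0; have p_gt1 := prime_gt1 p_pr.
have le_n2n : n <= n.*2 by lia.
have bin_fact2 : 'C(n.*2, n) * (n`! * n`!) = n.*2`!.
  by have <- := bin_fact le_n2n; rewrite (_ : n.*2 - n = n) //; lia.
have := congr1 (logn p) bin_fact2.
rewrite !lognM ?muln_gt0 ?fact_gt0 ?bin_gt0 //.
rewrite !(@logn_fact_widen p _ n.*2) // => def_v.
apply: leq_trans (sum_leq_indicator n.*2 (trunc_log p n.*2)).
suff : \sum_(1 <= k < n.*2.+1) n.*2 %/ p ^ k <=
    \sum_(1 <= k < n.*2.+1) (n %/ p ^ k + n %/ p ^ k + (k <= trunc_log p n.*2)).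
  by rewrite !big_split /=; lia.
apply: leq_sum => k _; have pk_gt0 : 0 < p ^ k by rewrite expn_gt0 ltnW.
case: (leqP k) => [_|lt_tk].
  by rewrite -addnn divnD // leq_add2l leq_b1.
rewrite divn_small //; apply: leq_trans (trunc_log_ltn _ p_gt1) _.
by rewrite leq_exp2l.
Qed.

(** A prime p > 2n has [trunc_log p n.*2 = 0], so it does not divide the binomial coefficient. *)
Lemma central_bin_prod n : 0 < n ->
  'C(n.*2, n) = \prod_(0 <= p < n.*2.+1) p ^ logn p 'C(n.*2, n).
Proof.
move=> n_gt0; set c := 'C(_, _).
have c_gt0 : 0 < c by rewrite bin_gt0; lia.
rewrite -{1}(partnT c_gt0) (@widen_partn (maxn c n.*2)) ?leq_maxl //.
rewrite (@big_cat_nat _ _ _ n.*2.+1) //= ?ltnS ?leq_maxr //.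
rewrite [X in _ * X]big_nat_cond [X in _ * X]big1 ?muln1 // => p.
rewrite andbT => /andP[lt_np _]; have [p_pr|] := boolP (prime p); last first.
  by rewrite lognE => /negPf->.
have := logn_central_bin p_pr n_gt0.
suff -> : trunc_log p n.*2 = 0 by rewrite leqn0 => /eqP->.
by apply/eqP; rewrite trunc_log_eq0; apply/orP; right; lia.
Qed.

Lemma prod_if_ltn_le m t x : 0 < x ->
  \prod_(0 <= p < m) (if p < t then x else 1) <= x ^ t.
Proof.
move=> x_gt0; suff -> : \prod_(0 <= p < m) (if p < t then x else 1) = x ^ minn m t.
  by rewrite leq_pexp2l ?geq_minr.
elim: m => [|m IHm]; first by rewrite big_geq // min0n.
rewrite big_nat_recr //= IHm; case: ltnP => h.
  by rewrite (minn_idPl h) expnSr.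
by rewrite muln1 (minn_idPr (leqW h)).
Qed.

(** Let v be the exponent of p. Each of the at most t primes below t contributes p^v <= 2n. For p >=
    t, p^2 > 2n forces v <= 1, so the contribution is at most p. *)
Lemma central_bin_upper_bound n t : 0 < n -> n.*2 < t ^ 2 ->
  'C(n.*2, n) <= n.*2 ^ t * \prod_(0 <= p < n.*2.+1 | prime p) p.
Proof.
move=> n_gt0 lt_nt2; have n2_gt0 : 0 < n.*2 by lia.
apply: leq_trans (leq_mul (prod_if_ltn_le n.*2.+1 t n2_gt0) (leqnn _)).
rewrite central_bin_prod // [X in _ * X]big_mkcond -big_split /=.
apply: leq_prod => p _; have [p_pr|] := boolP (prime p); last first.
  by rewrite lognE => /negPf-> /=; case: ifP; lia.
have p_gt1 := prime_gt1 p_pr; have := logn_central_bin p_pr n_gt0.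
case: ltnP => [lt_pt|le_tp] le_v.
  apply: leq_trans (leq_pmulr _ (ltnW p_gt1)).
  by apply: leq_trans (trunc_logP p_gt1 n2_gt0); rewrite leq_exp2l.
rewrite mul1n -[leqRHS]expn1 leq_exp2l // (leq_trans le_v) //.
rewrite -ltnS -(ltn_exp2l _ _ p_gt1) (leq_ltn_trans (trunc_logP p_gt1 n2_gt0)) //.
by rewrite (leq_trans lt_nt2) // leq_exp2r.
Qed.

Lemma pow8_le_pow2 t : 48 <= t -> t ^ 8 <= 2 ^ (t + 8).
Proof.
move=> t_ge48.
have le_pow2 u : 6 <= u -> 8 * u <= 2 ^ u.
  elim: u => // u IHu; rewrite leq_eqVlt => /predU1P[<- //|lt6u].
  by have := IHu lt6u; rewrite expnS; lia.
(* Since t <= 8u <= 2^u and 8u <= t + 8, taking eighth powers gives the claim. *)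
pose u := (t %/ 8).+1; have le_t8u : t <= 8 * u by rewrite /u; lia.
have le_8u : u * 8 <= t + 8 by rewrite /u; lia.
apply: leq_trans (_ : (2 ^ u) ^ 8 <= _); last by rewrite -expnM leq_exp2l.
by rewrite leq_exp2r // (leq_trans le_t8u) // le_pow2 // /u; lia.
Qed.

(** With t least such that t^2 > 2n and P the product of primes, the two binomial bounds give 4^n <=
    (2n)^(t + 1) P; it remains to see that (2n)^(t + 1) <= 2^n. *)
Lemma pow2_le_primorial n : 1152 <= n ->
  2 ^ n <= \prod_(0 <= p < n.*2.+1 | prime p) p.
Proof.
move=> n_ge; have n_gt0 : 0 < n by lia.
have ex_t : exists t, n.*2 < t ^ 2 by exists n.*2; rewrite -mulnn; nia.
case: (ex_minnP ex_t) => t lt_nt2 t_min.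
(* The threshold is chosen so that 2n >= 2 * 1152 = 48^2. *)
have t_ge : 49 <= t by nia.
have le_t1 : t.-1 ^ 2 <= n.*2.
  by rewrite leqNgt; apply/negP => /t_min; lia.
have le_pow : n.*2 ^ t.+1 <= 2 ^ n.
  apply: leq_trans (_ : (t ^ 2) ^ t.+1 <= _).
    by rewrite leq_exp2r // ltnW.
  (* In fourth powers: t^(8 (t + 1)) <= 2^((t + 8)(t + 1)), and (t + 8)(t + 1) <= 2 (t - 1)^2 <=
     4n. *)
  have pow4E : ((t ^ 2) ^ t.+1) ^ 4 = (t ^ 8) ^ t.+1.
    by rewrite -!expnM; congr (_ ^ _); lia.
  rewrite -(@leq_exp2r _ _ 4) // pow4E -(expnM 2).
  apply: leq_trans (_ : (2 ^ (t + 8)) ^ t.+1 <= _).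
    by rewrite leq_exp2r // pow8_le_pow2 //; lia.
  by rewrite -expnM leq_exp2l //; nia.
set P := \prod_(_ <= _ < _ | _) _.
have lower := central_bin_lower_bound n_gt0.
have upper := central_bin_upper_bound n_gt0 lt_nt2.
rewrite -(@leq_pmul2l (2 ^ n)) ?expn_gt0 //.
rewrite -expnMn (leq_trans lower) //.
apply: leq_trans (leq_mul le_pow (leqnn P)).
by rewrite expnS -mulnA leq_mul2l upper orbT.
Qed.

Lemma primorial_le m N : 0 < N ->
  (forall p, prime p -> p <= m -> p %| N) ->
  \prod_(0 <= p < m.+1 | prime p) p <= N.
Proof.
move=> N_gt0 dvdN.
rewrite -[leqRHS](partnT N_gt0) (@widen_partn (maxn N m)) ?leq_maxl //.
rewrite [leqRHS](@big_cat_nat _ _ _ m.+1) //= ?ltnS ?leq_maxr //.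
rewrite -[leqLHS]muln1 leq_mul //.
  rewrite big_mkcond [leqLHS]big_nat_cond [leqRHS]big_nat_cond.
  apply: leq_prod => p; rewrite andbT ltnS => /andP[_ le_pm].
  case: ifP => [p_pr|p_npr]; last by rewrite lognE p_npr.
  rewrite -[leqLHS]expn1 leq_exp2l ?prime_gt1 // logn_gt0 mem_primes p_pr N_gt0.
  exact: dvdN.
by rewrite big_nat_cond prodn_cond_gt0.
Qed.

(** The prime is the least one not dividing N; the alternative n < n0 covers the range below the
    threshold of the primorial bound. *)
Lemma exists_small_prime_ndvd : exists n0, forall N, 0 < N ->
  exists p n, [/\ prime p, ~~ (p %| N), p <= n.*2.+2 & n < n0 \/ 2 ^ n <= N].
Proof.
exists 1152 => N N_gt0; have ex_p : exists p, prime p && ~~ (p %| N).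
  have [p lt_Np p_pr] := prime_above N; exists p; rewrite p_pr /=.
  by apply/negP => /dvdn_leq; lia.
case: (ex_minnP ex_p) => p /andP[p_pr p_ndvd] p_min.
(* Minimality of p makes every prime up to 2n <= p - 1 divide N; rounding down in the half leaves p
   <= 2n + 2. *)
exists p, p.-1./2; split => //; first by lia.
case: ltnP => [|n_ge]; [by left|right].
apply: leq_trans (pow2_le_primorial n_ge) (primorial_le N_gt0 _) => r r_pr le_r.
by apply: contraTT isT => r_ndvd; have := p_min r; rewrite r_pr r_ndvd => /(_ isT); lia.
Qed.

End Chebyshev.

Local Open Scope classical_set_scope.
Local Open Scope complex_scope.
Local Open Scope ring_scope.

(** * Convergent series and uniqueness of power series coefficients *)

Section HasSum.
Variable R : realType.
Implicit Types (u v : nat -> R[i]) (c l m : R[i]).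

Lemma has_sumD u v l m :
  has_sum u l -> has_sum v m -> has_sum (fun n => u n + v n) (l + m).
Proof.
move=> hu hv; rewrite /has_sum.
have -> : series ((fun n => u n + v n) : nat -> R[i]^o) =
    (series (u : nat -> R[i]^o) \+ series (v : nat -> R[i]^o)).
  by apply/funext => n; rewrite /series /= big_split.
exact: (@cvgD R[i] R[i]^o).
Qed.

Lemma has_sumZ c u l : has_sum u l -> has_sum (fun n => c * u n) (c * l).
Proof.
move=> hu; rewrite /has_sum.
have -> : series ((fun n => c * u n) : nat -> R[i]^o) =
    (c \*: series (u : nat -> R[i]^o)).
  by apply/funext => n; rewrite /series /= -mulr_sumr.
exact: (@cvgZl_tmp R[i] R[i]^o).
Qed.

Lemma eq_has_sum u v l m : u =1 v -> l = m -> has_sum u l -> has_sum v m.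
Proof. by move=> /funext -> ->. Qed.

Lemma has_sum_sum (I : Type) (r : seq I) (u : I -> nat -> R[i]) (l : I -> R[i]) :
  (forall i, has_sum (u i) (l i)) ->
  has_sum (fun n => \sum_(i <- r) u i n) (\sum_(i <- r) l i).
Proof.
move=> hu; elim: r => [|i r IHr].
  rewrite big_nil /has_sum.
  have -> : series ((fun n => \sum_(i <- [::]) u i n) : nat -> R[i]^o) = cst 0.
    apply/funext => n; rewrite /series /= big1 // => j _; exact: big_nil.
  exact: cvg_cst.
rewrite big_cons; have := has_sumD (hu i) IHr; congr has_sum.
by apply/funext => n; rewrite big_cons.
Qed.

(* Reading a power series in w ^ p as a power series in w. *)
Lemma has_sum_dilate p u l : (0 < p)%N -> has_sum u l ->
  has_sum (fun n => if (p %| n)%N then u (n %/ p)%N else 0) l.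
Proof.
move=> p_gt0 hu; rewrite /has_sum.
(* The multiples of p below n number ceil(n / p), so partial sums of [v] are partial sums of [u] at
   that index. *)
set v := (fun n => _); pose ceil n := ((n + p.-1) %/ p)%N.
have -> : series (v : nat -> R[i]^o) = series (u : nat -> R[i]^o) \o ceil.
  apply/funext => n; rewrite /series /=; elim: n => [|n IHn].
    by rewrite /ceil add0n divn_small ?prednK // !big_geq.
  rewrite big_nat_recr //= {}IHn /v /ceil.
  have -> : (n.+1 + p.-1 = (n + p.-1).+1)%N by [].
  rewrite divnS // -addnS prednK // dvdn_addl //.
  case: ifP => [/dvdnP[q ->]|_]; last by rewrite addr0.
  rewrite divnMDl // divn_small ?prednK // addn0 mulnK //.
  by rewrite add1n big_nat_recr.
have ceil_oo : ceil @ \oo --> \oo.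
  exact: cvg_comp _ _ (cvg_addnr p.-1) (cvg_divnr p p_gt0).
exact: cvg_comp _ _ ceil_oo hu.
Qed.

Lemma has_sum_bounded u l : has_sum u l ->
  exists2 M : R[i], 0 < M & forall n, `|u n| <= M.
Proof.
move=> hu; have u0 : (u : nat -> R[i]^o) @ \oo --> (0 : R[i]^o).
  by apply: cvg_series_cvg_0; apply/cvg_ex; exists l.
have /cvg_seq_bounded : cvgn (u : nat -> R[i]^o) by apply/cvg_ex; exists 0.
case/pinfty_ex_gt0 => M M_gt0 uM; exists M => // n; exact: uM.
Qed.

(* If c_m is the first nonzero coefficient, then the terms beyond m are
   O(r ^ (m + 1)), hence |c_m| r ^ m = O(r ^ (m + 1)) as r -> 0. *)
Lemma power_series_eq0 (c : nat -> R[i]) :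
  (forall r : R[i], 0 < r < 1 -> has_sum (fun n => c n * r ^+ n) 0) ->
  forall n, c n = 0.
Proof.
move=> hc; have h01 : 0 < (2^-1 : R[i]) < 1.
  by rewrite invr_gt0 ltr0n invf_lt1 ?ltr0n ?ltr1n.
(* Convergence at 1/2 gives |c_n| <= M 2^n. *)
have [M M_gt0 cM] := has_sum_bounded (hc _ h01).
elim/ltn_ind => m IHm; apply/eqP; apply: contraT => cm_neq0.
have cm_gt0 : 0 < `|c m| by rewrite normr_gt0.
(* The radius r satisfies r <= 1/2 and K r < |c_m|, while evaluating the series at r/2 will give
   |c_m| <= K r. *)
set K := 2 ^+ m * (3 * M); have K_gt0 : 0 < K by rewrite !mulr_gt0 ?exprn_gt0.
pose r := `|c m| / (2 * (`|c m| + K)).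
have cK_gt0 : 0 < `|c m| + K by rewrite addr_gt0.
have r_gt0 : 0 < r by rewrite divr_gt0 ?mulr_gt0.
have r_le : r <= 2^-1.
  by rewrite /r invfM mulrCA ler_piMr // ?ler_pdivrMr // ?mul1r ?lerDl ?ltW.
have Kr_lt : K * r < `|c m|.
  rewrite /r mulrCA gtr_pMr // ltr_pdivrMr ?mulr_gt0 // mul1r.
  rewrite mulrDr -subr_gt0.
  have -> : 2 * `|c m| + 2 * K - K = 2 * `|c m| + K by ring.
  by rewrite addr_gt0 ?mulr_gt0.
have s01 : 0 < r / 2 < 1.
  rewrite divr_gt0 //= ltr_pdivrMr // mul1r (le_lt_trans r_le) //.
  by rewrite (lt_trans (andP h01).2) // ltr1n.
have rk_ge0 k : 0 <= r ^+ k by rewrite exprn_ge0 // ltW.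
(* At r/2 the k-th term is at most M r^k, and a geometric series of ratio r <= 1/2 is at most twice
   its first term. *)
have tail n : `|\sum_(m.+1 <= k < m.+1 + n) c k * (r / 2) ^+ k| <= 2 * M * r ^+ m.+1.
  apply: le_trans (_ : \sum_(m.+1 <= k < m.+1 + n) M * r ^+ k <= _).
    apply: (le_trans (ler_norm_sum _ _ _)); apply: ler_sum => k _.
    rewrite exprMn mulrCA normrM normrX (ger0_norm (ltW r_gt0)) mulrC.
    by rewrite ler_wpM2r ?rk_ge0.
  rewrite -{1}[m.+1]add0n big_addn addKn -mulr_sumr mulrAC mulrC ler_pM2r //.
  rewrite (eq_bigr (fun i => r ^+ i * r ^+ m.+1)) => [|i _]; last exact: exprD.
  rewrite -mulr_suml ler_wpM2r ?rk_ge0 //.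
  elim: n => [|n IHn]; first by rewrite big_geq.
  rewrite big_nat_recl //= expr0 (eq_bigr (fun i => r * r ^+ i)) => [|i _];
    last exact: exprS.
  rewrite -mulr_sumr -[leRHS]/(1 + 1 : R[i]) lerD2l.
  apply: (le_trans (ler_wpM2l (ltW r_gt0) IHn)).
  by rewrite -ler_pdivlMr // mul1r.
(* A late partial sum is below M r^(m + 1); with the tail bound this accounts for the factor 3 in
   [K]. *)
have eps_gt0 : 0 < M * r ^+ m.+1 by rewrite mulr_gt0 ?exprn_gt0.
have := hc _ s01 => /(@cvgr0_norm_lt _ _ _ _ _ _)/(_ _ eps_gt0) => -[n _ hn].
have := hn (m.+1 + n)%N (leq_addl _ _); rewrite /= /series /=.
rewrite (@big_cat_nat _ _ _ m.+1) ?leq_addr //= big_nat_recr //=.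
rewrite big_nat_cond big1 ?add0r; last first.
  by move=> k /andP[/andP[_ /IHm ->] _]; rewrite mul0r.
move=> lt_eps; suff : `|c m| <= K * r by move/(lt_le_trans Kr_lt); rewrite ltxx.
have : `|c m * (r / 2) ^+ m| <= 3 * M * r ^+ m.+1.
  set a := c m * _; set T := \sum_(_ <= _ < _) _ in lt_eps.
  rewrite -[a](addrK T); apply: (le_trans (ler_normB _ _)).
  have -> : 3 * M * r ^+ m.+1 = M * r ^+ m.+1 + 2 * M * r ^+ m.+1 by ring.
  by rewrite lerD ?tail // ltW.
rewrite normrM normrX (ger0_norm (ltW (andP s01).1)) exprMn exprVn mulrA.
rewrite ler_pdivrMr ?exprn_gt0 // exprSr.
have -> : 3 * M * (r ^+ m * r) * 2 ^+ m = K * r * r ^+ m by rewrite /K; ring.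
by rewrite ler_pM2r ?exprn_gt0.
Qed.

End HasSum.

(** * The exponential, the parameters q_h and roots of unity *)

Section Nome.
Variable R : realType.
Implicit Types (z w : R[i]) (p n : nat).

Lemma expCD z w : expC (z + w) = expC z * expC w.
Proof.
case: z w => [a b] [c d]; rewrite /expC /= expRD cosD sinD.
by apply/eqP; rewrite eq_complex /=; apply/andP; split; apply/eqP; ring.
Qed.

Lemma expC0 : expC 0 = 1 :> R[i].
Proof. by rewrite /expC /= expR0 cos0 sin0 mul1r. Qed.

Lemma expCMn n z : expC (n%:R * z) = expC z ^+ n.
Proof.
elim: n => [|n IHn]; first by rewrite mul0r expC0.
by rewrite -natr1 mulrDl mul1r expCD IHn exprSr.
Qed.

Lemma nomeE (h : nat) (x y : R) : nome h (x +i* y) =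
  (expR (- (2 * pi * y / h%:R)))%:C *
  (cos (2 * pi * x / h%:R) +i* sin (2 * pi * x / h%:R)).
Proof.
rewrite /nome -[h%:R](rmorph_nat (real_complex R)) -fmorphV /expC /=.
by rewrite !(mul0r, mulr0, subr0, sub0r, add0r, addr0) mulNr.
Qed.

Lemma nomeD (h : nat) z w : nome h (z + w) = nome h z * nome h w.
Proof. by rewrite /nome -expCD; congr expC; rewrite mulrDr mulrDl. Qed.

Lemma nomeMn (h : nat) n z : nome h (n%:R * z) = nome h z ^+ n.
Proof. by rewrite /nome -expCMn; congr expC; rewrite -!mulrA mulrCA. Qed.

Lemma nome1_div n z : nome 1 (z / n%:R) = nome n z.
Proof. by rewrite /nome invr1 mulr1 mulrA. Qed.

Lemma nome1E n z : (0 < n)%N -> nome 1 z = nome n z ^+ n.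
Proof.
move=> n_gt0; rewrite -[nome n z]nome1_div -nomeMn [n%:R * _]mulrC divfK //.
by rewrite pnatr_eq0 -lt0n.
Qed.

Lemma nome_root_expn n : (0 < n)%N -> nome n 1 ^+ n = 1 :> R[i].
Proof.
move=> n_gt0; rewrite -nome1E // -[1 in LHS]/(1 +i* 0) nomeE.
by rewrite mulr0 mul0r oppr0 expR0 mulr1 divr1 mulr_natl cos2pi sin2pi mul1r.
Qed.

(** The real part is 1 - 2 sin(pi / n)^2 < 1. *)
Lemma nome_root_neq1 n : (1 < n)%N -> nome n 1 != 1 :> R[i].
Proof.
move=> n_gt1; have n_gt0 : 0 < n%:R :> R by rewrite ltr0n ltnW.
set x : R := pi / n%:R.
have -> : nome n 1 = cos (x *+ 2) +i* sin (x *+ 2) :> R[i].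
  rewrite -[1]/(1 +i* 0) nomeE mulr0 mul0r oppr0 expR0 mul1r mulr1.
  by rewrite -mulrA mulr_natl.
rewrite eq_complex /= negb_and; apply/orP; left.
rewrite cos_mulr2n cos2sin2.
have sin_x_gt0 : 0 < sin x.
  apply: sin_gt0_pi; rewrite divr_gt0 ?pi_gt0 //=.
  by rewrite ltr_pdivrMr // ltr_pMr ?pi_gt0 // ltr1n.
by rewrite lt_eqF //; nra.
Qed.

(** The order of this root of unity divides the prime p and is not 1. *)
Lemma prime_nome_root_prim p : prime p -> p.-primitive_root (nome p 1 : R[i]).
Proof.
move=> p_pr; have p_gt0 := prime_gt0 p_pr.
have [m prim_m m_dvd] := prim_order_exists p_gt0 (nome_root_expn p_gt0).
have m_neq1 : m != 1%N.
  apply: contra_neq (nome_root_neq1 (prime_gt1 p_pr)) => m1.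
  by rewrite -[LHS]expr1 -m1 prim_expr_order.
by have /(prime_nt_dvdP p_pr m_neq1) m_p := m_dvd; rewrite -{1}m_p.
Qed.

Lemma sum_nome_root p n : prime p ->
  \sum_(b < p) nome p 1 ^+ (n * b) = if (p %| n)%N then p%:R else 0 :> R[i].
Proof.
move=> p_pr; have prim := prime_nome_root_prim p_pr.
rewrite (prim_order_dvd prim); case: eqP => [zn1|/eqP zn1].
  rewrite (eq_bigr (fun=> 1)) ?sumr_const ?card_ord // => b _.
  by rewrite exprM zn1 expr1n.
apply: (mulfI (_ : nome p 1 ^+ n - 1 != 0)); first by rewrite subr_eq0.
rewrite mulr0 (eq_bigr (fun b : 'I_p => (nome p 1 ^+ n) ^+ b)) => [|b _]; last first.
  by rewrite exprM.
by rewrite -subrX1 exprAC (prim_expr_order prim) expr1n subrr.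
Qed.

(** This turns identities between expansions on the half-plane into the hypothesis of
    [power_series_eq0]. The point is z = -i n ln(r) / (2 pi). *)
Lemma nome_surj n (r : R[i]) : (0 < n)%N -> 0 < r < 1 ->
  exists2 z, upper_half_plane z & nome n z = r.
Proof.
case: r => x y n_gt0; rewrite !ltcE /= => /andP[/andP[/eqP -> x_gt0] /andP[_ x_lt1]].
have n_gt0' : 0 < n%:R :> R by rewrite ltr0n.
have pi2_gt0 : 0 < 2 * pi :> R by rewrite mulr_gt0 ?pi_gt0.
exists (0 +i* (- (ln x * n%:R / (2 * pi)))).
  rewrite /upper_half_plane /= oppr_gt0 pmulr_llt0 ?invr_gt0 //.
  by rewrite pmulr_llt0 // ln_lt0 // x_gt0.
rewrite nomeE mulr0 mul0r cos0 sin0 mulr1.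
have -> : - (2 * pi * - (ln x * n%:R / (2 * pi)) / n%:R) = ln x.
  by rewrite mulrN mulNr opprK [_ * (_ / _)]mulrC divfK ?mulfK // gt_eqF.
by rewrite lnK ?posrE.
Qed.

End Nome.

(** * Hecke operators at primes not dividing the level *)

Section HeckePrime.
Variable R : realType.
Implicit Types (f : R[i] -> R[i]) (a : nat -> R[i]) (N p : nat) (k : int).

Lemma divisors_prime p : prime p -> perm_eq (divisors p) [:: 1%N; p].
Proof.
move=> p_pr; apply: uniq_perm; rewrite ?divisors_uniq //=.
  by rewrite inE andbT neq_ltn prime_gt1.
move=> d; rewrite -dvdn_divisors ?prime_gt0 // !inE.
apply/idP/orP => [|[] /eqP-> //]; rewrite ?dvd1n //.
by case: (primeP p_pr) => _ /[apply] /orP.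
Qed.

Lemma hecke_prime N k p f (z : R[i]) : prime p -> ~~ (p %| N)%N ->
  hecke N k p f z = p%:R ^ (k - 1) *
    (p%:R ^ (- k) * \sum_(b < p) f ((z + b%:R) / p%:R) + f (p%:R * z)).
Proof.
move=> p_pr p_ndvd; rewrite /hecke (perm_big _ (divisors_prime p_pr)) /=.
rewrite !big_cons big_nil coprime1n prime_coprime // p_ndvd addr0.
congr (_ * (_ + _)).
  rewrite divn1 mulr_sumr; by apply: eq_bigr => b _; rewrite mul1r.
rewrite divnn prime_gt0 // big_ord_recl big_ord0 !addr0 divr1.
by rewrite exp1rz mul1r.
Qed.

Lemma upper_half_plane_affine (s t : R) (z : R[i]) : 0 < s ->
  upper_half_plane z -> upper_half_plane (s%:C * z + t%:C).
Proof.
by case: z => x y s_gt0; rewrite /upper_half_plane /= mul0r !addr0; exact: mulr_gt0.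
Qed.

(** With zeta = q_p(1), the nome of (z + b)/p is zeta^b q_p(z); summing over b keeps only the
    exponents divisible by p. *)
Lemma has_sum_avg_translates f a p (z : R[i]) : prime p ->
  fourier_expansion 1 f a -> upper_half_plane z ->
  has_sum (fun n => if (p %| n)%N then p%:R * a n * nome p z ^+ n else 0)
    (\sum_(b < p) f ((z + b%:R) / p%:R)).
Proof.
move=> p_pr f_a zH.
have zbH b : upper_half_plane ((z + b%:R) / p%:R : R[i]).
  have := upper_half_plane_affine (b%:R / p%:R) (_ : 0 < p%:R^-1) zH.
  rewrite rmorphM !fmorphV !rmorph_nat [_ * z]mulrC -mulrDl; apply.
  by rewrite invr_gt0 ltr0n prime_gt0.
have := @has_sum_sum _ _ (index_enum 'I_p) _ _ (fun b => f_a _ (zbH (nat_of_ord b))).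
congr has_sum; apply/funext => n.
under eq_bigr => b _.
  rewrite nome1_div nomeD -[b%:R]mulr1 nomeMn exprMn mulrA -exprM mulnC.
  over.
rewrite -mulr_sumr sum_nome_root //.
by case: ifP => _; rewrite ?mulr0 // mulrC mulrA.
Qed.

(** All series are written in powers of q_p(z), using q_1(pz) = q_p(z)^(p^2) and q_1(z) = q_p(z)^p.
    Hence the index n is p times the usual exponent of q_1. *)
Lemma hecke_prime_eigen_coef N k p f a (lambda : R[i]) :
  prime p -> ~~ (p %| N)%N -> fourier_expansion 1 f a ->
  (forall z, upper_half_plane z -> hecke N k p f z = lambda * f z) ->
  forall n, (p %| n)%N ->
  a n + p%:R ^ (k - 1) * (if (p * p %| n)%N then a (n %/ (p * p))%N else 0)
    = lambda * a (n %/ p)%N.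
Proof.
move=> p_pr p_ndvd f_a f_eigen.
have p_gt0 := prime_gt0 p_pr; have pp_gt0 : (0 < p * p)%N by rewrite muln_gt0 p_gt0.
(* The n-th coefficient of T_p f - lambda f in powers of q_p. *)
pose c n := p%:R ^ (k - 1) *
    (p%:R ^ (- k) * (if (p %| n)%N then p%:R * a n else 0)
     + (if (p * p %| n)%N then a (n %/ (p * p))%N else 0))
  + - lambda * (if (p %| n)%N then a (n %/ p)%N else 0).
have c0 n : c n = 0.
  apply: power_series_eq0 n => r /(nome_surj p_gt0)[z zH <-].
  have pzH : upper_half_plane (p%:R * z : R[i]).
    have := upper_half_plane_affine 0 (_ : 0 < p%:R) zH.
    by rewrite rmorph0 addr0 rmorph_nat ltr0n; apply.
  have h1 := has_sum_avg_translates p_pr f_a zH.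
  have h2 := has_sum_dilate pp_gt0 (f_a _ pzH).
  have h3 := has_sum_dilate p_gt0 (f_a _ zH).
  have h12 := has_sumD (has_sumZ (c := p%:R ^ (- k)) h1) h2.
  have h := has_sumD (has_sumZ (c := p%:R ^ (k - 1)) h12) (has_sumZ (c := - lambda) h3).
  apply: (eq_has_sum _ _ h) => [m|]; last first.
    by rewrite mulNr -f_eigen // hecke_prime // subrr.
  rewrite /c mulrDl -!mulrA; congr (_ * _ + _ * _).
    rewrite mulrDl -mulrA; congr (_ * _ + _); first by case: ifP; rewrite ?mul0r ?mulrA.
    case: ifP => [/dvdnP[q ->]|_]; rewrite ?mul0r // mulnK //.
    by rewrite (nome1E _ p_gt0) nomeMn -!exprM mulnA mulnC.
  case: ifP => [/dvdnP[q ->]|_]; rewrite ?mul0r // mulnK //.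
  by rewrite (nome1E _ p_gt0) -exprM mulnC.
move=> n p_n; have := c0 n; rewrite /c p_n => /eqP; rewrite mulNr subr_eq0 => /eqP <-.
have p_neq0 : p%:R != 0 :> R[i] by rewrite pnatr_eq0 -lt0n.
(* The factor in front of a_n is p^(k - 1) p^(-k) p = 1. *)
rewrite mulrDr !mulrA -expfzDr // -[X in _ * X * a n]expr1z -expfzDr //.
by rewrite (_ : k - 1 - k + 1 = 0) ?expr0z ?mul1r //; ring.
Qed.

(** The coefficient relation at n = p identifies lambda with a_p, as a_1 = 1; at n = p^2 it becomes
    the claim. *)
Lemma hecke_recurrence N k p f a :
  prime p -> ~~ (p %| N)%N -> normalised_eigenform N k f a ->
  a (p * p)%N = a p ^+ 2 - p%:R ^ (k - 1).
Proof.
move=> p_pr p_ndvd [[_ _ f_eigen] f_a a1].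
have p_gt0 := prime_gt0 p_pr.
have [lambda f_lambda] := f_eigen p p_gt0.
have coef := hecke_prime_eigen_coef p_pr p_ndvd f_a f_lambda.
have := coef p (dvdnn p); rewrite divnn p_gt0 a1 mulr1.
have -> : (p * p %| p)%N = false.
  by apply/negP => /(dvdn_leq p_gt0); have := prime_gt1 p_pr; nia.
rewrite mulr0 addr0 => ap.
have := coef (p * p)%N (dvdn_mulr p (dvdnn p)).
rewrite dvdnn divnn muln_gt0 p_gt0 mulKn // a1 mulr1 ap => /eqP.
by rewrite -expr2 eq_sym -subr_eq => /eqP.
Qed.

Lemma exprz_natr_inj p (k l : int) : (1 < p)%N ->
  p%:R ^ k = p%:R ^ l :> R[i] -> k = l.
Proof.
wlog le_kl : k l / k <= l => [hwlog|] p_gt1 eq_kl.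
  by case/orP: (le_total k l) => h; [|apply/esym]; exact: hwlog.
have p_neq0 : p%:R != 0 :> R[i] by rewrite pnatr_eq0 -lt0n ltnW.
have : p%:R ^ (l - k) = 1 :> R[i].
  by rewrite expfzDr // -eq_kl -expfzDr // subrr expr0z.
have : 0 <= l - k by rewrite subr_ge0.
case def_d : (l - k) => [d|//] _.
rewrite -exprnP -natrX => /eqP; rewrite pnatr_eq1 -(expn0 p) eqn_exp2l // => /eqP.
by lia.
Qed.

End HeckePrime.

(** * A coefficient of index O((log N)^2) that separates the forms *)

Section SmallCoefficient.
Variable R : realType.

Lemma exists_prime_ndvd_le_ln : exists2 K : R, 0 < K &
  forall N : nat, (0 < N)%N -> 1 <= ln (N%:R : R) ->
  exists p, [/\ prime p, ~~ (p %| N)%N & p%:R <= K * ln (N%:R : R)].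
Proof.
have ln2_gt0 : 0 < ln (2 : R) by rewrite ln_gt0 // ltr1n.
have iln2_gt0 : 0 < 2 / ln (2 : R) by rewrite divr_gt0.
have [n0 small_prime] := exists_small_prime_ndvd.
(* The first summand bounds p when n < n0, and otherwise the 2 in p <= 2n + 2; the second comes from
   n <= ln N / ln 2. Constants are absorbed using ln N >= 1. *)
exists (n0.*2.+2%:R + 2 / ln 2) => [|N N_gt0 lnN_ge1]; first by rewrite addr_gt0.
have [p [n [p_pr p_ndvd le_pn n_small]]] := small_prime N N_gt0.
exists p; split => //; have lnN_ge0 : 0 <= ln (N%:R : R) by apply: le_trans lnN_ge1.
rewrite mulrDl; case: n_small => [lt_n|le_N].
  apply: le_trans (_ : n0.*2.+2%:R <= _).
    by rewrite ler_nat (leq_trans le_pn) // ltnS ltnS leq_double ltnW.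
  rewrite -[leLHS]addr0 lerD //; last by rewrite mulr_ge0 // ltW.
  by rewrite ler_peMr.
have le_lnN : n%:R * ln 2 <= ln (N%:R : R).
  rewrite mulr_natl -lnXn // -natrX ler_ln ?posrE ?ltr0n ?expn_gt0 //.
  by rewrite ler_nat.
have le_n : n%:R <= ln (N%:R : R) / ln 2 by rewrite ler_pdivlMr.
have le_p : p%:R <= 2 * n%:R + 2 :> R by rewrite -natrM -natrD ler_nat; lia.
have -> : 2 / ln 2 * ln (N%:R : R) = 2 * (ln N%:R / ln 2) by rewrite mulrAC mulrA.
apply: le_trans le_p _; rewrite addrC lerD ?ler_pM2l //.
apply: le_trans (_ : n0.*2.+2%:R <= _); first by rewrite ler_nat.
by rewrite ler_peMr.
Qed.

(** [E] stands for the second summand of each of the three bounds; its nonnegativity is asked only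
    where ln x >= 1, so that ln (ln x) may occur in it. *)
Lemma coefficients_differ_within_ln2 (E : R -> R) :
  (forall x, 1 <= ln x -> 0 <= E x) ->
  coefficients_differ_within (fun x => (ln x + E x) ^+ 2).
Proof.
move=> E_ge0; have [K K_gt0 small_prime] := exists_prime_ndvd_le_ln.
(* The constant is squared because the index may be p^2; the threshold exceeds e, which ensures ln N
   >= 1. *)
exists (K ^+ 2), (Num.bound (expR 1 : R)); split; first by rewrite exprn_gt0.
move=> N N_gt0 le_N k1 k2 f g a b fa gb k_neq.
have lnN_ge1 : 1 <= ln (N%:R : R).
  rewrite -[leLHS]expRK ler_ln ?posrE ?expR_gt0 ?ltr0n //.
  rewrite ltW // (lt_le_trans (archi_boundP (expR_ge0 1))) //.
  by rewrite ler_nat.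
have [p [p_pr p_ndvd le_p]] := small_prime N N_gt0 lnN_ge1.
have p_gt0 := prime_gt0 p_pr.
have le_pp : (p * p)%:R <= K ^+ 2 * (ln N%:R + E N%:R) ^+ 2.
  rewrite -exprMn natrM -expr2 lerXn2r ?nnegrE ?ler0n //.
    by rewrite mulr_ge0 ?(ltW K_gt0) // addr_ge0 ?E_ge0 // (le_trans _ lnN_ge1).
  by rewrite (le_trans le_p) // ler_pM2l // lerDl E_ge0.
have [ab_p|/eqP ab_p] := eqVneq (a p) (b p).
  exists (p * p)%N; split; rewrite ?muln_gt0 ?p_gt0 // => ab_pp.
  apply: k_neq; apply: (addIr (- 1)).
  apply: (@exprz_natr_inj R p _ _ (prime_gt1 p_pr)).
  move: ab_pp; rewrite (hecke_recurrence p_pr p_ndvd fa).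
  by rewrite (hecke_recurrence p_pr p_ndvd gb) ab_p => /addrI /oppr_inj.
exists p; split => //; apply: le_trans le_pp.
by rewrite ler_nat leq_pmulr.
Qed.

End SmallCoefficient.

End Auxiliary.

Import Order.TTheory GRing.Theory Num.Theory.

Theorem theorem5 (R : realType) :
  [/\ coefficients_differ_within
        (fun x : R => (ln x + ln x `^ (525 / 1000)) ^+ 2),
      riemann_hypothesis R ->
      coefficients_differ_within
        (fun x : R => (ln x + ln x `^ (1 / 2) * ln (ln x)) ^+ 2)
    & cramer_conjecture R ->
      coefficients_differ_within
        (fun x : R => (ln x + ln (ln x) ^+ 2) ^+ 2)].
Proof.
split=> [|_|_]; apply: coefficients_differ_within_ln2 => x lnx_ge1.
- exact: powR_ge0.
- by rewrite mulr_ge0 ?powR_ge0 ?ln_ge0.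
- exact: sqr_ge0.
Qed.
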